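(* Let $\mu\in\mathcal{F}^9$ be a filiform Lie bracket of dimension $9$ with parameters $(a_{r,s})_{(r,s)\in\Delta_9}$, and let $U^9$ be the Zariski open subset of $\mathcal{F}^9$ defined by $$a_{1,4}\ne 0,\quad a_{1,5}\ne 0,\quad 3a_{2,6}a_{1,5}(a_{1,4}-a_{2,6})\ne 2a_{2,7}a_{1,4}^2,\quad 2a_{2,6}-a_{1,4}\ne 0,\quad a_{3,8}\ne 0.$$ If $\mu\in U^9$, then the filiform Lie bracket $\mu_t=\mu+t\psi_{1,6}$ ($t\in\mathbb{C}$) is not isomorphic to $\mu$, except for $t=0$.
   Context: Let $n=9$ and let $x_0,\dots,x_{n-1}$ be a basis of $\mathbb{C}^n$. Let $\mu_0$ be the alternating bilinear map with $\mu_0(x_0,x_j)=x_{j+1}$ for $1\le j\le n-2$, and $\mu_0(x_i,x_j)=0$ for all other $i<j$. Let $\Delta_n=\{(r,s): 1\le r\le n-2,\ 2r+1<s\le n-1\}$ (here $n$ is odd). For $(r,s)\in\Delta_n$ let $\psi_{r,s}$ be the alternating bilinear map with $$\psi_{r,s}(x_i,x_j)=-\psi_{r,s}(x_j,x_i)=(-1)^{r-i}\binom{j-r-1}{r-i}x_{i+j+s-2r-1}$$ for $1\le i\le r<j\le n-1$ and $i+j+s-2r-1\le n-1$, and $\psi_{r,s}(x_i,x_j)=0$ otherwise. $\mathcal{F}^n$ is the algebraic set of tuples $(a_{r,s})_{(r,s)\in\Delta_n}$ of complex numbers such that $\psi=\sum_{(r,s)\in\Delta_n}a_{r,s}\psi_{r,s}$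 satisfies $\psi(\psi(X,Y),Z)+\psi(\psi(Y,Z),X)+\psi(\psi(Z,X),Y)=0$ for all $X,Y,Z$. The tuple is identified with the filiform Lie bracket $\mu=\mu_0+\psi$ on $\mathbb{C}^n$. A filiform Lie algebra of dimension $n$ is a nilpotent one of maximal class $n-1$. Isomorphic means isomorphic as complex Lie algebras. *)

(* Defs.v *)
From HB Require Import structures.
From mathcomp Require Import all_boot all_order all_algebra.
From mathcomp Require Import reals.
From mathcomp Require Export complex.

Set Implicit Arguments.
Unset Strict Implicit.
Unset Printing Implicit Defensive.

Import GRing.Theory.
Local Open Scope ring_scope.

Section Brackets.
Variables (K : fieldType) (n : nat).
Local Notation V := 'rV[K]_n.

Definition is_lie_bracket (m : V -> V -> V) : Prop :=
  [/\ forall X, linear (m X),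
      forall Y, linear (fun X => m X Y),
      forall X, m X X = 0
    & forall X Y Z, m (m X Y) Z + m (m Y Z) X + m (m Z X) Y = 0].

Definition bracket_vs (m : V -> V -> V) (U W : {vspace V}) : {vspace V} :=
  <<[seq m u w | u <- vbasis U, w <- vbasis W]>>%VS.

(* lcs m 0 is the whole algebra, so the nilpotency class is the least k *)
(* with lcs m k = 0.                                                     *)
Fixpoint lcs (m : V -> V -> V) (k : nat) : {vspace V} :=
  if k is k'.+1 then bracket_vs m fullv (lcs m k') else fullv.

Definition nilpotent_of_class (m : V -> V -> V) (c : nat) : Prop :=
  lcs m c = 0%VS /\ forall k, (k < c)%N -> lcs m k <> 0%VS.

Definition is_filiform_lie_bracket (m : V -> V -> V) : Prop :=
  is_lie_bracket m /\ nilpotent_of_class m n.-1.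

Definition isomorphic (m1 m2 : V -> V -> V) : Prop :=
  exists f : {linear V -> V},
    bijective f /\ forall X Y, f (m1 X Y) = m2 (f X) (f Y).

Definition x_ (k : nat) : V := \row_(j < n) (k == j)%:R.

(* The alternating bilinear map whose value at (x_i, x_j) is b i j for   *)
(* i < j; the values of b at other pairs are irrelevant.                 *)
Definition alt_ext (b : nat -> nat -> V) (X Y : V) : V :=
  \sum_(i < n) \sum_(j < n | (i < j)%N)
    (X 0 i * Y 0 j - X 0 j * Y 0 i) *: b i j.

Lemma alt_ext_basis b i j :
  (i < j < n)%N -> alt_ext b (x_ i) (x_ j) = b i j.
Proof.
case/andP=> ij jn; have in_ := ltn_trans ij jn.
rewrite /alt_ext (bigD1 (Ordinal in_)) //= (bigD1 (Ordinal jn)) //=.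
rewrite !mxE !eqxx (gtn_eqF ij) mulr0 subr0 mulr1 scale1r.
rewrite !big1 ?addr0 // => [i' ne_i | j' /andP[lt_j ne_j]].
  apply: big1 => j' lt_j; rewrite !mxE.
  have -> : (i == i') = false.
    by apply: contraNF ne_i => /eqP e; apply/eqP/val_inj.
  case: (eqVneq i j') => [e|_]; last by rewrite !mul0r subr0 scale0r.
  have -> : (j == i') = false by rewrite gtn_eqF // (ltn_trans _ ij) // e.
  by rewrite mul0r mulr0 subr0 scale0r.
rewrite !mxE.
have -> : (j == j') = false.
  by apply: contraNF ne_j => /eqP e; apply/eqP/val_inj.
by rewrite (ltn_eqF lt_j) mulr0 mul0r subr0 scale0r.
Qed.

Definition mu0 : V -> V -> V :=
  alt_ext (fun i j =>
    if (i == 0)%N && (1 <= j <= n - 2)%N then x_ j.+1 else 0).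

Definition psi_ (r s : nat) : V -> V -> V :=
  alt_ext (fun i j =>
    if (1 <= i <= r)%N && (r < j <= n - 1)%N
       && (i + j + s - 2 * r - 1 <= n - 1)%N
    then ((-1) ^+ (r - i) *+ 'C(j - r - 1, r - i))
           *: x_ (i + j + s - 2 * r - 1)
    else 0).

(* The index set for odd n. *)
Definition Delta (r s : nat) : bool :=
  (1 <= r <= n - 2)%N && (2 * r + 1 < s <= n - 1)%N.

(* A tuple indexed by Delta is given by a total function a on pairs of   *)
(* naturals, of which only the values on Delta are used.                 *)
Definition psi_sum (a : nat -> nat -> K) (X Y : V) : V :=
  \sum_(r < n) \sum_(s < n | Delta r s) a r s *: psi_ r s X Y.

Definition in_F (a : nat -> nat -> K) : Prop :=
  let psi := psi_sum a in
  forall X Y Z, psi (psi X Y) Z + psi (psi Y Z) X + psi (psi Z X) Y = 0.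

Definition mu (a : nat -> nat -> K) (X Y : V) : V :=
  mu0 X Y + psi_sum a X Y.

End Brackets.

Arguments mu0 {K} n X Y.
Arguments psi_ {K} n r s X Y.
Arguments psi_sum {K} n a X Y.
Arguments in_F {K} n a.
Arguments mu {K} n a X Y.

Definition in_U9 (K : fieldType) (a : nat -> nat -> K) : Prop :=
  in_F 9 a /\
  [/\ a 1%N 4%N != 0,
      a 1%N 5%N != 0,
      3 * a 2%N 6%N * a 1%N 5%N * (a 1%N 4%N - a 2%N 6%N) != 2 * a 2%N 7%N * a 1%N 4%N ^+ 2,
      2 * a 2%N 6%N - a 1%N 4%N != 0
    & a 3%N 8%N != 0].

(* Main.v *)
(** Jacobi for [psi] in dimension 9 is the single equation
    a38 (2 a14 + a26) = 3 a26^2, which does not involve a16, so every [mu_t] is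
    again a filiform Lie bracket.

    An isomorphism f from [mu_t] to [mu] respects the flag of the spaces
    <x_i, ..., x_8> and is determined by f x_0 = p x_0 + p1 x_1 + p2 x_2 + ...
    and f x_1 = q1 x_1 + q2 x_2 + q3 x_3 + ...  Comparing the coordinates of
    f [x_1, x_2] and f [x_2, x_3] by weight (the weight of x_k in [x_i, x_j]
    being k - i - j) gives:
    - weight 1: q1 = p^2, from a14 <> 0;
    - weight 2: a15 p (1 - p) = 2 a14^2 p1 and
      a27 p (1 - p) = 3 a26 (a14 - a26) p1; the third condition on [mu] is the
      nonvanishing of the determinant, so p1 = 0, and then p = 1 as a15 <> 0;
    - weight 3: modulo the Jacobi equation, a38 (q2^2 - 2 q3) = 0 and
      t = a26 (q2^2 - 2 q3), so t = 0 as a38 <> 0. *)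
Require Import Defs.
From HB Require Import structures.
From mathcomp Require Import all_boot all_order all_algebra.
From mathcomp Require Import boolp reals complex.
From mathcomp Require Import ring zify.

Set Implicit Arguments.
Unset Strict Implicit.
Unset Printing Implicit Defensive.

Import GRing.Theory.
Local Open Scope ring_scope.

Ltac case_lt9 k lt_k9 :=
  move: k lt_k9 => [|[|[|[|[|[|[|[|[|?]]]]]]]]] // _.
Ltac vm_in_goal u := let v := eval vm_compute in u in change u with v.

(** * Coordinates of the brackets and the Jacobi identity *)

Section Coordinates.
Variable (K : fieldType).
Local Notation V := 'rV[K]_9.

(** Indices are plain numerals, so that case analysis computes; out of range [inord] falls back to
    0, whence the bounds [k < 9] below. *)
Definition crd (k : nat) (X : V) : K := X 0 (inord k).

Lemma crd_is_linear k : scalar (crd k).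
Proof. by move=> a X Y; rewrite /crd !mxE. Qed.
HB.instance Definition _ k :=
  GRing.isLinear.Build K V K *%R (crd k) (@crd_is_linear k).

Lemma crdP (X Y : V) : (forall k, (k < 9)%N -> crd k X = crd k Y) -> X = Y.
Proof.
move=> eqXY; apply/rowP=> k; have := eqXY k (ltn_ord k).
by rewrite /crd inord_val.
Qed.

Lemma crd_x i k : (k < 9)%N -> crd k (x_ K 9 i) = (i == k)%:R.
Proof. by move=> lt_k9; rewrite /crd mxE inordK. Qed.

Definition det2 (X Y : nat -> K) (i j : nat) : K := X i * Y j - X j * Y i.

Definition pairs (P : nat -> nat -> bool) : seq (nat * nat) :=
  [seq (i, j) | i <- iota 0 9, j <- [seq j <- iota 0 9 | P i j]].

Lemma big_pairs P (F : nat -> nat -> K) :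
  \sum_(p <- pairs P) F p.1 p.2 = \sum_(i < 9) \sum_(j < 9 | P i j) F i j.
Proof.
rewrite big_allpairs_dep -[iota 0 9]/(index_iota 0 9) big_mkord.
by apply: eq_bigr => i _; rewrite big_filter big_mkord.
Qed.

Definition psi_coef r i j : int := (-1) ^+ (r - i) *+ 'C(j - r - 1, r - i).

Definition psi_pairs k r s : seq (nat * nat) :=
  pairs (fun i j => (i < j)%N && ((1 <= i <= r)%N && (r < j <= 8)%N
                      && (i + j + s - 2 * r - 1 == k)%N)).

Lemma crd_psi k r s X Y : (k < 9)%N ->
  crd k (psi_ 9 r s X Y) =
  \sum_(p <- psi_pairs k r s)
     (psi_coef r p.1 p.2)%:~R * det2 (crd^~ X) (crd^~ Y) p.1 p.2.
Proof.
move=> lt_k9; rewrite linear_sum.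
rewrite (@big_pairs _
  (fun i j => (psi_coef r i j)%:~R * det2 (crd^~ X) (crd^~ Y) i j)).
apply: eq_bigr => i _; rewrite linear_sum /= big_mkcondr /=.
apply: eq_bigr => j lt_ij; rewrite linearZ /= /det2 /crd !inord_val mulrC.
rewrite -/(crd k _) -[(i + j + s - _ - 1 <= _)%N]/(_ < 9)%N.
case: ifP => [/andP[-> lt9]|].
  rewrite linearZ /= crd_x // /psi_coef rmorphMn rmorphXn rmorphN rmorph1 /=.
  by case: eqP; rewrite ?mulr1 // mulr0 mul0r.
rewrite linear0 mul0r => /negbT cnd; case: ifP => // /andP[Hij /eqP Hk].
by move: cnd; rewrite Hij Hk lt_k9.
Qed.

(* Closed data for each numeral [k], so that the nonzero structure constants
   are found by evaluation. *)
Definition psi_table k : seq (nat * nat * seq (nat * nat * int)) :=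
  [seq (rs, [seq (p, psi_coef rs.1 p.1 p.2) | p <- psi_pairs k rs.1 rs.2])
  | rs <- pairs (@Delta 9)].

Lemma crd_psi_sum k a X Y : (k < 9)%N ->
  crd k (psi_sum 9 a X Y) =
  \sum_(u <- psi_table k)
     a u.1.1 u.1.2 *
       \sum_(q <- u.2) q.2%:~R * det2 (crd^~ X) (crd^~ Y) q.1.1 q.1.2.
Proof.
move=> lt_k9; rewrite big_map (@big_pairs _ (fun r s => a r s *
  (\sum_(q <- [seq (p, psi_coef r p.1 p.2) | p <- psi_pairs k r s])
     q.2%:~R * det2 (crd^~ X) (crd^~ Y) q.1.1 q.1.2))).
rewrite linear_sum; apply: eq_bigr => r _; rewrite linear_sum /=.
by apply: eq_bigr => s _; rewrite linearZ /= crd_psi // big_map.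
Qed.

Section Structure.
Variables (a : nat -> nat -> K) (X Y : nat -> K).
Local Notation d := (det2 X Y).

(** The structure constants of [mu] in closed form, on sequences so as to serve both for vectors and
    for the rows of the matrix of a map. *)
Definition br (k : nat) : K :=
  match k with
  | 2%N => d 0 1
  | 3%N => d 0 2
  | 4%N => d 0 3 + a 1 4 * d 1 2
  | 5%N => d 0 4 + a 1 5 * d 1 2 + a 1 4 * d 1 3
  | 6%N => d 0 5 + a 1 6 * d 1 2 + a 1 5 * d 1 3 + a 1 4 * d 1 4
           + a 2 6 * (d 2 3 - d 1 4)
  | 7%N => d 0 6 + a 1 7 * d 1 2 + a 1 6 * d 1 3 + a 1 5 * d 1 4
           + a 1 4 * d 1 5 + a 2 7 * (d 2 3 - d 1 4)
           + a 2 6 * (d 2 4 - 2 * d 1 5)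
  | 8%N => d 0 7 + a 1 8 * d 1 2 + a 1 7 * d 1 3 + a 1 6 * d 1 4
           + a 1 5 * d 1 5 + a 1 4 * d 1 6 + a 2 8 * (d 2 3 - d 1 4)
           + a 2 7 * (d 2 4 - 2 * d 1 5) + a 2 6 * (d 2 5 - 3 * d 1 6)
           + a 3 8 * (d 3 4 - d 2 5 + d 1 6)
  | _ => 0
  end.

Definition jacobi9 : Prop := a 3 8 * (2 * a 1 4 + a 2 6) = 3 * a 2 6 ^+ 2.
End Structure.

Implicit Types (a : nat -> nat -> K) (X Y Z : V).

Lemma crd_mu0 k X Y : (k < 9)%N ->
  crd k (mu0 9 X Y) = if (1 < k)%N then det2 (crd^~ X) (crd^~ Y) 0 k.-1 else 0.
Proof.
move=> lt_k9.
rewrite linear_sum [LHS]big_ord_recl [X in _ + X]big1 => [|i _]; last first.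
  by rewrite [LHS]linear_sum big1 // => j _; rewrite andFb scaler0 linear0.
rewrite addr0 [LHS]linear_sum (eq_bigr (fun j : 'I_9 =>
  if (nat_of_ord j == k.-1) && (1 < k)%N
  then det2 (crd^~ X) (crd^~ Y) 0 j else 0)) /=.
  case: ifP => lt1k; last by rewrite big1 // => j _; rewrite andbF.
  rewrite (bigD1 (inord k.-1)) /= inordK ?eqxx /=; [|lia..].
  rewrite big1 ?addr0 // => j /andP[_ /negPf nj]; rewrite ifF //.
  by rewrite -nj andbT -val_eqE /= inordK //; lia.
move=> j lt0j; rewrite linearZ /=.
rewrite (_ : (0 < j <= 9 - 2)%N = (j < 8)%N); last by lia.
case: ifP => lt_j8; last first.
  by rewrite linear0 mulr0 ifF //; apply/negP=> /andP[/eqP Hj]; lia.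
rewrite crd_x //; case: eqP => [<-|neq]; last first.
  by rewrite mulr0 ifF //; apply/negP=> /andP[/eqP Hj Hk]; lia.
rewrite eqxx ltnS lt0j mulr1 /det2 /crd !inord_val (_ : inord 0 = ord0) //.
by apply/val_inj; rewrite /= inordK.
Qed.

Lemma crd_mu a k X Y : (k < 9)%N ->
  crd k (mu 9 a X Y) = br a (crd^~ X) (crd^~ Y) k.
Proof.
move=> lt_k9; rewrite linearD /= crd_mu0 // crd_psi_sum //.
by case_lt9 k lt_k9;
  match goal with |- context[psi_table ?k] => vm_in_goal (psi_table k) end;
  rewrite /= ?(big_cons, big_nil) /fst /snd /= /det2; ring.
Qed.

Lemma crd_psi_sumE a X Y k :
  crd k (psi_sum 9 a X Y) = crd k (mu 9 a X Y) - crd k (mu0 9 X Y).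
Proof. by rewrite linearD addrAC subrr add0r. Qed.

(** The relation is, up to sign, the x_8 coefficient of the Jacobi sum of x_1, x_2, x_3. *)
Lemma in_F9_jacobi9 a : in_F 9 a -> jacobi9 a.
Proof.
move=> /(_ (x_ K 9 1) (x_ K 9 2) (x_ K 9 3)) /(congr1 (crd 8)).
rewrite !linearD /= linear0 !crd_psi_sumE !crd_mu // !crd_mu0 //= /det2.
rewrite !crd_psi_sumE !crd_mu // !crd_mu0 //= /det2 !crd_x //= => E.
apply/eqP; rewrite -subr_eq0 -oppr_eq0 -[X in _ == X]E; apply/eqP; ring.
Qed.

Lemma mu_linearr a X : linear (mu 9 a X).
Proof.
move=> c Y Z; apply: crdP => k lt_k9; rewrite linearP /= !crd_mu //.
case_lt9 k lt_k9; rewrite /= /det2 ?linearP /=; ring.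
Qed.

Lemma mu_alt a X : mu 9 a X X = 0.
Proof.
apply: crdP => k lt_k9; rewrite linear0 !crd_mu //.
case_lt9 k lt_k9; rewrite /= /det2; ring.
Qed.

Lemma mu_linearl a Y : linear ((mu 9 a)^~ Y).
Proof.
move=> c X Z; apply: crdP => k lt_k9; rewrite linearP /= !crd_mu //.
case_lt9 k lt_k9; rewrite /= /det2 ?linearP /=; ring.
Qed.

Lemma mu_jacobi a X Y Z : jacobi9 a ->
  mu 9 a (mu 9 a X Y) Z + mu 9 a (mu 9 a Y Z) X + mu 9 a (mu 9 a Z X) Y = 0.
Proof.
rewrite /jacobi9 => rel; apply: crdP => k lt_k9.
rewrite linear0 2!linearD /= !crd_mu //.
(* Below x_8 the Jacobi sum vanishes identically in the parameters. *)
have [lt_k8|le8k] := ltnP k 8.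
  case: k lt_k8 {lt_k9} => [|[|[|[|[|[|[|[|]]]]]]]] // _;
    rewrite /= /det2 ?crd_mu //= /det2; ring.
have -> : k = 8 by lia.
rewrite /= /det2 ?crd_mu //= /det2.
(* The x_8 coordinate is the relation times the 3 by 3 minor of [X], [Y], [Z] on the coordinates 1,
   2, 3. *)
transitivity
  ((3 * a 2%N 6%N ^+ 2 - a 3%N 8%N * (2 * a 1%N 4%N + a 2%N 6%N)) *
   (crd 1 X * det2 (crd^~ Y) (crd^~ Z) 2 3
    - crd 2 X * det2 (crd^~ Y) (crd^~ Z) 1 3
    + crd 3 X * det2 (crd^~ Y) (crd^~ Z) 1 2)).
  by rewrite /det2; ring.
by rewrite rel subrr mul0r.
Qed.
End Coordinates.

(** * Triangular shape of the bracket *)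

Section Bracket.
Variables (K : fieldType) (a : nat -> nat -> K).
Implicit Types X Y : nat -> K.

(** Every minor in coordinate [k] has both indices below [k]. *)
Lemma br_eq0 X Y k : (forall j, (j < k)%N -> Y j = 0) -> br a X Y k = 0.
Proof.
case: k => [|[|[|[|[|[|[|[|[|k]]]]]]]]] // Y0; rewrite /= /det2;
  repeat match goal with |- context[Y ?j] => rewrite (Y0 j isT) end; ring.
Qed.

(** In coordinate [k.+1] only the minor with indices 0 and [k] reaches the index [k]. *)
Lemma br_lead X Y k : (0 < k < 8)%N -> (forall j, (j < k)%N -> Y j = 0) ->
  br a X Y k.+1 = X 0%N * Y k.
Proof.
case: k => [|[|[|[|[|[|[|[|k]]]]]]]] // _ Y0; rewrite /= /det2;
  repeat match goal with |- context[Y ?j] => rewrite (Y0 j isT) end; ring.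
Qed.
End Bracket.

(** * Comparison of weights for an isomorphism *)

Section Rigidity.
Variables (K : fieldType) (a : nat -> nat -> K) (t : K).
(* [F i k] stands for the coordinate of f x_i on x_k. *)
Variable F : nat -> nat -> K.

Hypothesis F0 : forall i k, (0 < i < 8)%N -> (k < 9)%N ->
  F i.+1 k = br a (F 0) (F i) k.
(** Bracketing with f x_0 moves one step down the flag; the first bracket already kills the
    coordinates 0 and 1. *)
Lemma F_low i j : (1 < i < 9)%N -> (j < i)%N -> F i j = 0.
Proof.
elim: i j => [|[|i] IHi] // j lti ltj; rewrite F0 //; last by lia.
case: i IHi lti ltj => [|i] IHi lti ltj; first by case: j ltj => [|[]].
by apply: br_eq0 => j' ltj'; apply: IHi; lia.
Qed.

Lemma F_diag i : (1 < i < 8)%N -> F i.+1 i.+1 = F 0 0 * F i i.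
Proof.
move=> lti; rewrite F0 ?br_lead //; try lia.
by move=> j ltj; rewrite F_low //; lia.
Qed.

(** Turns a goal that is [c] times a known equation into a polynomial identity for [ring]. *)
Lemma eq_lincomb (c l r x y : K) : l = r -> x - y = c * (l - r) -> x = y.
Proof. by move=> ->; rewrite subrr mulr0 => /eqP; rewrite subr_eq0 => /eqP. Qed.
Arguments eq_lincomb c {l r x y}.

(** The right side expands f [x_1, x_2] with the source bracket mu_t, whence [a 1 6 + t];
    [psi_ 9 1 6] does not affect [x_0, x_i] or [x_2, x_3]. *)
Hypothesis F12 : forall k, (k < 9)%N -> br a (F 1) (F 2) k =
  a 1 4 * F 4 k + a 1 5 * F 5 k + (a 1 6 + t) * F 6 k + a 1 7 * F 7 k
  + a 1 8 * F 8 k.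
Hypothesis F23 : forall k, (k < 9)%N -> br a (F 2) (F 3) k =
  a 2 6 * F 6 k + a 2 7 * F 7 k + a 2 8 * F 8 k.
Hypothesis F88 : F 8 8 != 0.
Hypothesis Ua : in_U9 a.

Lemma weight3_rigidity : t = 0.
Proof.
have [/in_F9_jacobi9 rel [a14 a15 disc _ a38]] := Ua.
have low := (
  @F_low 2 0 isT isT, @F_low 2 1 isT isT, @F_low 3 0 isT isT,
  @F_low 3 1 isT isT, @F_low 3 2 isT isT, @F_low 4 0 isT isT,
  @F_low 4 1 isT isT, @F_low 4 2 isT isT, @F_low 4 3 isT isT,
  @F_low 5 0 isT isT, @F_low 5 1 isT isT, @F_low 5 2 isT isT,
  @F_low 5 3 isT isT, @F_low 5 4 isT isT, @F_low 6 0 isT isT,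
  @F_low 6 1 isT isT, @F_low 6 2 isT isT, @F_low 6 3 isT isT,
  @F_low 6 4 isT isT, @F_low 6 5 isT isT, @F_low 7 0 isT isT,
  @F_low 7 1 isT isT, @F_low 7 2 isT isT, @F_low 7 3 isT isT,
  @F_low 7 4 isT isT, @F_low 7 5 isT isT, @F_low 7 6 isT isT,
  @F_low 8 0 isT isT, @F_low 8 1 isT isT, @F_low 8 2 isT isT,
  @F_low 8 3 isT isT, @F_low 8 4 isT isT, @F_low 8 5 isT isT,
  @F_low 8 6 isT isT, @F_low 8 7 isT isT).
(* Six steps along the diagonal give [F 8 8 = F 0 0 ^+ 6 * F 2 2]. *)
have [p_neq0 u_neq0] : F 0 0 != 0 /\ F 2 2 != 0.
  move: F88; do 6! rewrite F_diag //; rewrite !mulf_eq0.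
  by case: (F 0 0 =P 0); case: (F 2 2 =P 0).
have F22 : F 2 2 = F 0 0 * F 1 1 - F 0 1 * F 1 0 by rewrite F0.
(* In coordinate 3 the right side of [F12] vanishes and the left is [F 1 0 * F 2 2]. *)
have q0 : F 1 0 = 0.
  have E := F12 (isT : 3 < 9)%N; rewrite /= /det2 !low in E.
  apply: (mulIf u_neq0); apply: (eq_lincomb 1 E); ring.
have F44 : F 4 4 = F 0 0 ^+ 2 * F 2 2 by rewrite 2?F_diag //; ring.
have q1 : F 1 1 = F 0 0 ^+ 2.
  have E := F12 (isT : 4 < 9)%N; rewrite /= /det2 !low q0 F44 in E.
  apply: (mulIf u_neq0); apply: (mulfI a14).
  apply: (eq_lincomb 1 E); ring.
move: F22 F44; rewrite q0 q1 mulr0 subr0 -exprS => F22 F44.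
have x23 : F 2 3 = F 0 0 * F 1 2 by rewrite F0 //= /det2 ?q0; ring.
have F33 : F 3 3 = F 0 0 ^+ 4 by rewrite F_diag // F22; ring.
have F34 : F 3 4 = F 0 0 ^+ 2 * F 1 2 + a 1 4 * F 0 1 * F 0 0 ^+ 3.
  by rewrite F0 //= /det2 !low ?x23 ?F22; ring.
have F45 : F 4 5 = F 0 0 ^+ 3 * F 1 2 + 2 * a 1 4 * F 0 1 * F 0 0 ^+ 4.
  by rewrite F0 //= /det2 !low ?F34 ?F33; ring.
have F55 : F 5 5 = F 0 0 ^+ 6 by rewrite F_diag // F44 F22; ring.
have F66 : F 6 6 = F 0 0 ^+ 7 by rewrite F_diag // F55; ring.
have F77 : F 7 7 = F 0 0 ^+ 8 by rewrite F_diag // F66; ring.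
have F56 : F 5 6 =
    F 0 0 ^+ 4 * F 1 2 + (3 * a 1 4 - a 2 6) * F 0 1 * F 0 0 ^+ 5.
  by rewrite F0 //= /det2 !low ?F45 ?F44 ?F22; ring.
have F67 : F 6 7 =
    F 0 0 ^+ 5 * F 1 2 + (4 * a 1 4 - 3 * a 2 6) * F 0 1 * F 0 0 ^+ 6.
  by rewrite F0 //= /det2 !low ?F56 ?F55; ring.
(* Weight 2: coordinate 5 of [F12] here, coordinate 7 of [F23] next, each divided by a power of
   [F 0 0]; the terms in [F 1 2] cancel. *)
have E15 : a 1 5 * (F 0 0 * (1 - F 0 0)) = 2 * a 1 4 ^+ 2 * F 0 1.
  have := F12 (isT : 5 < 9)%N.
  rewrite /= /det2 !low ?q0 ?q1 ?F22 ?x23 ?F45 ?F55 ?F44 => E.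
  by apply: (mulfI (expf_neq0 4 p_neq0)); apply: (eq_lincomb 1 E); ring.
have E27 : a 2 7 * (F 0 0 * (1 - F 0 0)) = 3 * a 2 6 * (a 1 4 - a 2 6) * F 0 1.
  have := F23 (isT : 7 < 9)%N.
  rewrite /= /det2 !low ?F22 ?x23 ?F33 ?F34 ?F66 ?F77 ?F67 => E.
  by apply: (mulfI (expf_neq0 6 p_neq0)); apply: (eq_lincomb 1 E); ring.
(* Eliminating [F 0 0 * (1 - F 0 0)] between [E15] and [E27] leaves the determinant times
   [F 0 1]. *)
have p1 : F 0 1 = 0.
  apply: (mulIf (_ : 3 * a 2 6 * a 1 5 * (a 1 4 - a 2 6)
                     - 2 * a 2 7 * a 1 4 ^+ 2 != 0)); first by rewrite subr_eq0.
  transitivity (a 2 7 * (a 1 5 * (F 0 0 * (1 - F 0 0)) - 2 * a 1 4 ^+ 2 * F 0 1)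
    - a 1 5 * (a 2 7 * (F 0 0 * (1 - F 0 0))
               - 3 * a 2 6 * (a 1 4 - a 2 6) * F 0 1)); first by ring.
  by rewrite E15 E27 !subrr !mulr0 subrr mul0r.
have p0 : F 0 0 = 1.
  move: E15; rewrite p1 mulr0 => /eqP; rewrite !mulf_eq0 (negPf a15).
  by rewrite (negPf p_neq0) subr_eq0 => /eqP.
(* The matrix is now unipotent, and the entries next to the diagonal from row 1 on equal [F 1 2];
   weight 3 needs the next diagonal. *)
move: F22 x23 F33 F34 F45 F55 F66 F77 F56 F67 F44.
rewrite p1 p0 !expr1n !mulr0 ?mul0r !addr0 !mul1r.
move=> F22 x23 F33 F34 F45 F55 F66 F77 F56 F67 F44.
have F24 : F 2 4 = F 1 3 - a 1 4 * F 0 2.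
  by rewrite F0 //= /det2 ?p0 ?p1 ?q0 ?q1 ?p0; ring.
have F35 : F 3 5 = F 1 3 - a 1 4 * F 0 2.
  by rewrite F0 //= /det2 !low ?p0 ?p1 ?F24 ?F22 ?x23; ring.
have F46 : F 4 6 = F 1 3 - a 1 4 * F 0 2 + a 2 6 * F 0 2.
  by rewrite F0 //= /det2 !low ?p0 ?p1 ?F35 ?F33 ?F34; ring.
have F57 : F 5 7 = F 1 3 - a 1 4 * F 0 2 + 2 * a 2 6 * F 0 2.
  by rewrite F0 //= /det2 !low ?p0 ?p1 ?F46 ?F44 ?F45 ?F22; ring.
have F68 : F 6 8 = F 1 3 - a 1 4 * F 0 2 + 3 * a 2 6 * F 0 2 - a 3 8 * F 0 2.
  by rewrite F0 //= /det2 !low ?p0 ?p1 ?F57 ?F55 ?F56; ring.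
have F88' : F 8 8 = 1 by rewrite F_diag // F77 p0 mulr1.
have F78 : F 7 8 = F 1 2.
  by rewrite F0 //= /det2 !low ?p0 ?p1 ?F67 ?F66; ring.
have q3 : F 1 2 ^+ 2 - 2 * F 1 3 = 0.
  have := F23 (isT : 8 < 9)%N.
  rewrite /= /det2 !low ?F22 ?x23 ?F24 ?F33 ?F34 ?F35 ?F68 ?F78 ?F88' => E.
  apply: (mulfI a38); apply: (eq_lincomb 1 E).
  (* What remains besides [F 1 2 ^+ 2 - 2 * F 1 3] is [F 0 2] times the Jacobi relation. *)
  suff : F 0 2 * (a 3 8 * (2 * a 1 4 + a 2 6)) = F 0 2 * (3 * a 2 6 ^+ 2).
    by move=> E2; rewrite mulr0; apply: (eq_lincomb (-1) E2); ring.
  by rewrite rel.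
(* Coordinate 6 is the first one where [t] survives, since [F 6 k] vanishes for k < 6. *)
have := F12 (isT : 6 < 9)%N.
rewrite /= /det2 !low ?q0 ?q1 ?p0 ?F22 ?x23 ?F24 ?F46 ?F56 ?F66 => E.
transitivity (a 2 6 * (F 1 2 ^+ 2 - 2 * F 1 3)); last by rewrite q3 mulr0.
by apply: (eq_lincomb (-1) E); ring.
Qed.
End Rigidity.

(** * Brackets of subspaces *)

Section LowerCentralSeries.
Variables (K : fieldType) (n : nat) (m : 'rV[K]_n -> 'rV[K]_n -> 'rV[K]_n).

Lemma bracket_vs_sub (U W S : {vspace 'rV[K]_n}) :
  (forall u w, u \in U -> w \in W -> m u w \in S) ->
  (bracket_vs m U W <= S)%VS.
Proof.
move=> mS; apply/span_subvP => v /allpairsP[[u w] /= [uU wW ->]].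
by apply: mS; apply: vbasis_mem.
Qed.

Lemma mem_linear_vbasis (f : 'rV[K]_n -> 'rV[K]_n) (U S : {vspace 'rV[K]_n}) :
  linear f -> (forall v, v \in (vbasis U : seq _) -> f v \in S) ->
  forall u, u \in U -> f u \in S.
Proof.
move=> f_lin fS u /coord_vbasis ->.
pose fL : {linear _ -> _} := HB.pack f (GRing.isLinear.Build _ _ _ _ f f_lin).
rewrite -[f _]/(fL _) linear_sum; apply: memv_suml => i _.
by rewrite linearZ memvZ // fS // mem_nth // size_tuple.
Qed.

(** Only brackets of basis vectors are generators, so linearity is used in one argument after the
    other. *)
Lemma mem_bracket_vs (U W : {vspace 'rV[K]_n}) u w :
  (forall Y, linear (m^~ Y)) -> (forall X, linear (m X)) ->
  u \in U -> w \in W -> m u w \in bracket_vs m U W.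
Proof.
move=> m_linl m_linr uU wW.
apply: (mem_linear_vbasis (m_linl w)) uU => {u} u uU /=.
apply: (mem_linear_vbasis (m_linr u)) wW => {w} w wW /=.
by apply/memv_span/allpairsP; exists (u, w).
Qed.
End LowerCentralSeries.

(** * Nilpotency class and the deformed bracket *)

Section Filiform.
Variables (K : fieldType) (a : nat -> nat -> K).
Local Notation V := 'rV[K]_9.

Lemma mu_x0 i : (0 < i < 8)%N -> mu 9 a (x_ K 9 0) (x_ K 9 i) = x_ K 9 i.+1.
Proof.
move=> lti; apply: crdP => k lt_k9; rewrite crd_mu // crd_x //.
case: i lti => [|[|[|[|[|[|[|[|i]]]]]]]] // _;
  case_lt9 k lt_k9;
  rewrite /= /det2 ?crd_x //=; ring.
Qed.

(** The first bracket kills the coordinates 0 and 1 together, each later one kills one more; hence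
    the term of index 8 is zero. *)
Lemma lcs_mu_low k v j : (0 < k)%N -> v \in lcs (mu 9 a) k ->
  (j < 9)%N -> (j <= k)%N -> crd j v = 0.
Proof.
elim: k v j => // k IHk v j _ vk lt_j9 le_jk.
(* As a kernel, the vanishing of a coordinate becomes a subspace to which [bracket_vs_sub]
   applies. *)
pose c : 'Hom(V, K^o) := linfun (crd j : V -> K^o).
suff : v \in lker c by rewrite memv_ker lfunE => /eqP.
apply: subvP vk; apply: bracket_vs_sub => u w _ wk.
rewrite memv_ker lfunE /= crd_mu //; case: k IHk le_jk wk => [|k] IHk le_jk wk.
  by case: j {c lt_j9} le_jk => [|[]].
by apply/eqP/br_eq0 => i ltij; apply: (IHk w i) => //; lia.
Qed.

(** Iterating [x_0, -] from x_1 gives a nonzero vector in each term of index below 8. *)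
Lemma x_lcs_mu k : (k < 8)%N -> x_ K 9 k.+1 \in lcs (mu 9 a) k.
Proof.
elim: k => [|k IHk] ltk; first exact: memvf.
rewrite -mu_x0 //=; apply: mem_bracket_vs; rewrite ?memvf ?IHk //; last by lia.
- exact: mu_linearl.
- exact: mu_linearr.
Qed.

Lemma mu_filiform : jacobi9 a -> is_filiform_lie_bracket (mu 9 a).
Proof.
move=> jac; split.
  split=> [||X|X Y Z].
  - exact: mu_linearr.
  - exact: mu_linearl.
  - exact: mu_alt.
  - exact: mu_jacobi.
split=> [|k ltk].
  apply/eqP; rewrite -subv0; apply/subvP => v vk; rewrite memv0; apply/eqP.
  by apply: crdP => j lt_j9; rewrite linear0; apply: (lcs_mu_low _ vk).
move=> lcs0; have := x_lcs_mu ltk.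
rewrite lcs0 memv0 => /eqP /(congr1 (crd k.+1)).
by rewrite linear0 crd_x // eqxx => /eqP; rewrite oner_eq0.
Qed.

(** Makes mu_t another instance of [mu], so that the results on [mu] apply to it. *)
Definition shift16 (t : K) (r s : nat) : K :=
  if (r == 1)%N && (s == 6)%N then a r s + t else a r s.

Lemma mu_shift16 t X Y :
  mu 9 (shift16 t) X Y = mu 9 a X Y + t *: psi_ 9 1 6 X Y.
Proof.
apply: crdP => k lt_k9; rewrite [RHS]linearD linearZ /= !crd_mu // crd_psi //.
by case_lt9 k lt_k9;
  match goal with |- context[psi_pairs ?k 1 6] =>
    vm_in_goal (psi_pairs k 1 6) end;
  rewrite !(big_cons, big_nil) /= /shift16 /=;
  try match goal with |- context[psi_coef ?r ?i ?j] =>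
    vm_in_goal (psi_coef r i j) end;
  rewrite /det2; ring.
Qed.

Lemma mu_x1_x2 : mu 9 a (x_ K 9 1) (x_ K 9 2) =
  a 1 4 *: x_ K 9 4 + a 1 5 *: x_ K 9 5 + a 1 6 *: x_ K 9 6
  + a 1 7 *: x_ K 9 7 + a 1 8 *: x_ K 9 8.
Proof.
apply: crdP => k lt_k9; rewrite crd_mu // !linearD !linearZ /= !crd_x //.
by case_lt9 k lt_k9;
  rewrite /= /det2 ?crd_x //=; ring.
Qed.

Lemma mu_x2_x3 : mu 9 a (x_ K 9 2) (x_ K 9 3) =
  a 2 6 *: x_ K 9 6 + a 2 7 *: x_ K 9 7 + a 2 8 *: x_ K 9 8.
Proof.
apply: crdP => k lt_k9; rewrite crd_mu // !linearD !linearZ /= !crd_x //.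
by case_lt9 k lt_k9;
  rewrite /= /det2 ?crd_x //=; ring.
Qed.
End Filiform.

(** * Isomorphisms between mu_t and mu *)

Lemma isomorphic_shift16 (K : fieldType) (a : nat -> nat -> K) t :
  in_U9 a -> isomorphic (mu 9 (shift16 a t)) (mu 9 a) -> t = 0.
Proof.
move=> Ua [f [/bij_inj f_inj fM]].
have fE X Y k : (k < 9)%N -> crd k (f (mu 9 (shift16 a t) X Y)) =
    br a ((@crd K)^~ (f X)) ((@crd K)^~ (f Y)) k.
  by move=> ?; rewrite fM crd_mu.
pose F i k := crd k (f (x_ K 9 i)).
have F0 i k : (0 < i < 8)%N -> (k < 9)%N -> F i.+1 k = br a (F 0%N) (F i) k.
  by move=> lti ltk; rewrite /F -(mu_x0 (shift16 a t)) // fE.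
apply: (@weight3_rigidity K a t F) => // [k ltk|k ltk|].
- by rewrite -fE // mu_x1_x2 !linearD !linearZ.
- by rewrite -fE // mu_x2_x3 !linearD !linearZ.
(* The coordinates of f x_8 below 8 vanish by [F_low]; were the last one zero, f would not be
   injective. *)
apply/eqP => F88; have /(congr1 (crd 8)) : x_ K 9 8 = 0.
  apply: f_inj; rewrite linear0; apply: crdP => k ltk; rewrite linear0.
  move: ltk; rewrite ltnS leq_eqVlt => /predU1P[->|ltk]; first exact: F88.
  exact: (F_low F0 (isT : 1 < 8 < 9)%N ltk).
by rewrite linear0 crd_x // => /eqP; rewrite oner_eq0.
Qed.

Local Open Scope complex_scope.

Theorem proposition5p1 (R : realType) (a : nat -> nat -> R[i]) :
  in_U9 a ->
  forall t : R[i],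
    let mu_t := fun X Y => mu 9 a X Y + t *: psi_ 9 1 6 X Y in
    is_filiform_lie_bracket mu_t /\ (isomorphic mu_t (mu 9 a) <-> t = 0).
Proof.
move=> Ua t mu_t.
have -> : mu_t = mu 9 (shift16 a t).
  by apply: funext => X; apply: funext => Y; rewrite mu_shift16.
(* [jacobi9] does not read the entry (1,6), so its instances at [a] and [shift16 a t] are
   convertible. *)
split; first by apply: mu_filiform; have [/in_F9_jacobi9] := Ua.
split=> [|t0]; first exact: isomorphic_shift16.
exists idfun; split=> [|X Y]; first by exists idfun.
by rewrite mu_shift16 t0 scale0r addr0.
Qed.
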